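(* Let $(T,X,\pi)$ be an M-semiflow on a uniform space $(X,\mathscr{U}_X)$, where $T$ is a topological semigroup, which satisfies one of the following conditions: (1) $(T,X,\pi)$ is non-equicontinuous, $T$ is abelian and $X$ is a compact Hausdorff space; (2) $(T,X,\pi)$ is non-minimal. Then $(T,X,\pi)$ is sensitive to initial conditions.
   Context: A topological semiflow $(T,X,\pi)$ consists of a topological semigroup $T$ (not necessarily discrete), a topological space $X$ and a jointly continuous map $\pi\colon T\times X\to X$, $(t,x)\mapsto tx$, with $s(tx)=(st)x$ for all $s,t\in T$, $x\in X$, and $ex=x$ for all $x$ if $T$ has a neutral element $e$. Write $Tx=\{tx : t\in T\}$ and $t^{-1}V=\{x\in X : tx\in V\}$. Here $\mathscr{U}_X$ is a symmetric uniform structure compatible with the topology of $X$, and $\varepsilon[x]=\{y : (x,y)\in\varepsilon\}$ for $\varepsilon\in\mathscr{U}_X$. A subset $B\subseteq T$ is syndetic if there is a compact $K\subseteq T$ with $Kt\cap B\neq\emptyset$ for all $t\in T$. A point $x\in X$ is almost periodic if for every neighborhood $U$ of $x$ the set $N_T(x,U)=\{t\in T : tx\in U\}$ is syndetic in $T$. $(T,X,\pi)$ is topologically transitive if for all nonempty open $U,V\subseteq X$ there is $t\in T$ with $U\cap t^{-1}V\neq\emptyset$. An M-semiflow is a topologically transitive semiflow whose set of almost periodic points is dense in $X$. $(T,X,\pi)$ is minimal if $\overline{Tx}=X$ for every $x\in X$. It is equicontinuous at $x\in X$ if for every $\varepsilon\in\mathscr{U}_X$ there is $\delta\in\mathscr{U}_X$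 such that $(tx,ty)\in\varepsilon$ for all $y\in\delta[x]$ and all $t\in T$; it is equicontinuous if it is so at every point of $X$. It is sensitive to initial conditions if there is $\varepsilon\in\mathscr{U}_X$ such that for every $x\in X$ and every $\delta\in\mathscr{U}_X$ there are $y\in\delta[x]$ and $t\in T$ with $(tx,ty)\notin\varepsilon$. *)

(* Defs.v *)
From HB Require Import structures.
From mathcomp Require Import all_boot.
From mathcomp Require Import all_classical topology.

Set Implicit Arguments.
Unset Strict Implicit.
Unset Printing Implicit Defensive.

Local Open Scope classical_set_scope.

HB.mixin Record TopologicalMagma_hasContinuousMul T
    of Topological T & Semigroup T := {
  mulg_continuous : continuous (fun p : T * T => (p.1 * p.2)%g) ;
}.

(* No separation axiom is assumed, and the semigroup need not have a neutral
   element. *)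
#[short(type="topologicalSemigroupType")]
HB.structure Definition TopologicalSemigroup :=
  {T of Topological T & Semigroup T & TopologicalMagma_hasContinuousMul T}.

Definition neutral (T : semigroupType) (e : T) : Prop :=
  left_id e (fun s t : T => (s * t)%g) /\ right_id e (fun s t : T => (s * t)%g).

Definition abelian (T : semigroupType) : Prop :=
  commutative (fun s t : T => (s * t)%g).

Record semiflow (T : topologicalSemigroupType) (X : topologicalType) := Semiflow {
  flow :> T -> X -> X ;
  flow_continuous : continuous (fun p : T * X => flow p.1 p.2) ;
  flowM : forall s t x, flow s (flow t x) = flow (s * t)%g x ;
  flow_neutral : forall e, neutral e -> forall x, flow e x = x
}.

Definition syndetic (T : topologicalSemigroupType) (B : set T) : Prop :=
  exists2 K : set T, compact K &
    forall t : T, [set (k * t)%g | k in K] `&` B !=set0.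

Section topological_dynamics.
Variables (T : topologicalSemigroupType) (X : topologicalType).
Variable pi : semiflow T X.

Definition orbit (x : X) : set X := range (fun t => pi t x).

Definition return_times (x : X) (U : set X) : set T := [set t | U (pi t x)].

Definition almost_periodic (x : X) : Prop :=
  forall U : set X, nbhs x U -> syndetic (return_times x U).

Definition topologically_transitive : Prop :=
  forall U V : set X, open U -> U !=set0 -> open V -> V !=set0 ->
    exists t : T, U `&` (pi t @^-1` V) !=set0.

Definition M_semiflow : Prop :=
  topologically_transitive /\ dense [set x | almost_periodic x].

Definition minimal : Prop := forall x : X, closure (orbit x) = [set: X].

End topological_dynamics.

Section uniform_dynamics.
Variables (T : topologicalSemigroupType) (X : uniformType).
Variable pi : semiflow T X.

(* [xsection D x] is the set D[x] of all y such that (x, y) belongs to D.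
   The library's [equicontinuous] is not used because it requires a pointed
   codomain. *)
Definition equicontinuous_at (x : X) : Prop :=
  forall E : set (X * X), entourage E ->
    exists2 D : set (X * X), entourage D &
      forall y, xsection D x y -> forall t : T, E (pi t x, pi t y).

Definition equicontinuous_semiflow : Prop :=
  forall x : X, equicontinuous_at x.

Definition sensitive : Prop :=
  exists2 E : set (X * X), entourage E &
    forall (x : X) (D : set (X * X)), entourage D ->
      exists y (t : T), xsection D x y /\ ~ E (pi t x, pi t y).

End uniform_dynamics.

(* Main.v *)
Require Import Defs.
From mathcomp Require Import all_boot.
From mathcomp Require Import all_classical topology.

(** Sensitivity fails exactly when, for every entourage [E], some nonempty open
    set [U] is [E]-stable: any two points of [U] stay [E]-close along their
    whole forward orbits.  Under either hypothesis such sets lead to a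
    contradiction.

    Non-minimal case ([non_minimal_M_semiflow_sensitive]).  Let [z] be at
    positive distance from the orbit of [x0], and let [U] be stable at a small
    scale.  Some [s] carries a point of [U] near [z], and this point can be
    taken almost periodic, so that it comes back near itself, and [s] sends it
    back near [z], at a syndetic set of times; let [K] be the compact set
    witnessing this.  Transitivity brings another point of [U], at some time
    [t], so close to [x0] that it follows [x0] under all of [sK].  Some
    [skt] with [k] in [K] therefore sends one point of [U] near [z] and another
    one near the orbit of [x0], which stability forbids.

    Minimal abelian case ([minimal_abelian_equicontinuous]).  Let [U] be stable
    at a small scale, [x] a point of [U] and [w] any point.  Minimality gives
    [t] with [tw] in [U], and then [r] with [rtx] in [U].  As [x] and [rtx] both
    lie in [U], commutativity makes [rt] close to the identity along the orbit
    of [x], hence on all of [X].  For [y] near [w] the points [ty] and [tw]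
    both lie in [U], so that [sy], [rtsy = rs(ty)], [rtsw = rs(tw)] and [sw]
    are successively close for every [s]: the semiflow is equicontinuous
    at [w]. *)

Local Open Scope classical_set_scope.

(** * Entourages and open sets *)

Lemma entourage_third (X : uniformType) (E : set (X * X)) :
  entourage E -> exists F : set (X * X), [/\ entourage F,
    forall a b, F (a, b) -> F (b, a) &
    forall a b c d, F (a, b) -> F (b, c) -> F (c, d) -> E (a, d)].
Proof.
move=> entE; pose H := split_ent (split_ent E).
have entH : entourage H by do 2 apply: entourage_split_ent.
exists (H `&` H^-1%relation); split; first exact: entourage_invI.
  by move=> a b [Hab Hba]; split.
move=> a b c d [Hab _] [Hbc _] [Hcd _].
apply: (entourage_split c entE).
  by apply: (entourage_split b) Hab Hbc; exact: entourage_split_ent.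
by apply: split_ent_subset Hcd; exact: entourage_split_ent.
Qed.

Lemma near_entourage (X : uniformType) (x : X) (E : set (X * X)) :
  entourage E -> \forall y \near x, E (x, y).
Proof. by move=> entE; apply: filterS (nbhs_entourage x entE) => y /xsectionP. Qed.

(** A jointly continuous family indexed by a compact set is equicontinuous at
    every point. *)
Lemma compact_family_equicontinuous (S X : topologicalType) (Y : uniformType)
    (f : S * X -> Y) (K : set S) (x : X) (E : set (Y * Y)) :
  continuous f -> compact K -> entourage E ->
  \forall x' \near x, forall k, K k -> E (f (k, x), f (k, x')).
Proof.
move=> fC /compact_near_coveringP Kcov entE.
have [F [entF Fsym F3]] := entourage_third _ _ entE.
apply: (Kcov _ _ (fun x' k => E (f (k, x), f (k, x')))) => k Kk.
have [[A B] /= [nA nB] AB] := fC (k, x) _ (near_entourage _ (f (k, x)) _ entF).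
exists (A, B) => //= -[k' x'] [/= Ak' Bx'].
apply: (F3 _ (f (k, x)) (f (k, x))); last by apply: (AB (k', x')).
  by apply: Fsym; apply: (AB (k', x)); split=> //=; exact: nbhs_singleton.
exact: entourage_refl.
Qed.

(** * Stable open sets *)

Lemma flow_time_continuous (T : topologicalSemigroupType) (X : topologicalType)
    (pi : semiflow T X) (t : T) : continuous (pi t).
Proof.
move=> x; apply: (@continuous_comp _ _ _ (pair t) (fun p => pi p.1 p.2)).
  by apply: cvg_pair; [exact: cvg_cst | exact: cvg_id].
exact: flow_continuous.
Qed.

Definition stable (T : topologicalSemigroupType) (X : uniformType)
    (pi : semiflow T X) (E : set (X * X)) (U : set X) : Prop :=
  forall y y', U y -> U y' -> forall t, E (pi t y, pi t y').

Lemma not_sensitive_stable (T : topologicalSemigroupType) (X : uniformType)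
    (pi : semiflow T X) (E : set (X * X)) :
  ~ sensitive pi -> entourage E ->
  exists U : set X, [/\ open U, U !=set0 & stable _ _ pi E U].
Proof.
move=> nsens entE; have [F [entF Fsym F3]] := entourage_third _ _ entE.
apply: contrapT => noU; apply: nsens; exists F => // x D entD.
apply: contrapT => close; apply: noU; exists (interior (xsection D x)); split.
- exact: open_interior.
- by exists x; exact: nbhs_entourage.
have xF y t : interior (xsection D x) y -> F (pi t x, pi t y).
  move=> /interior_subset Dxy; apply: contrapT => nF.
  by apply: close; exists y, t.
move=> y y' Uy Uy' t; apply: (F3 _ (pi t x) (pi t x)).
- exact/Fsym/xF.
- exact: entourage_refl.
- exact: xF.
Qed.

Lemma minimal_visits (T : topologicalSemigroupType) (X : topologicalType)
    (pi : semiflow T X) (x : X) (U : set X) :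
  minimal pi -> open U -> U !=set0 -> exists t, U (pi t x).
Proof.
move=> min oU [u Uu]; have : closure (Defs.orbit pi x) u by rewrite min.
by case/(_ U (open_nbhs_nbhs (conj oU Uu))) => _ [[t _ <-] Ut]; exists t.
Qed.

(** * Minimal semiflows of abelian semigroups *)

(** Being close to the identity at the single point [x] for all times means,
    since [q] commutes with the semigroup, being close to it on the orbit of
    [x]; density of the orbit spreads this to [X]. *)
Lemma near_identity (T : topologicalSemigroupType) (X : uniformType)
    (pi : semiflow T X) (E : set (X * X)) :
  entourage E -> exists2 F : set (X * X), entourage F &
    abelian T -> forall (x : X) (q : T), closure (Defs.orbit pi x) = setT ->
      (forall s, F (pi s x, pi s (pi q x))) -> forall z, E (z, pi q z).
Proof.
move=> entE; have [F [entF Fsym F3]] := entourage_third _ _ entE.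
exists F => // abT x q dx Fx z.
have : closure (Defs.orbit pi x) z by rewrite dx.
have nz : \forall y \near z, F (z, y) /\ F (pi q z, pi q y).
  apply: filterI; first exact: near_entourage.
  exact: (flow_time_continuous _ _ pi q z _ (near_entourage _ (pi q z) _ entF)).
case/(_ _ nz) => _ [[s _ <-] [zs qzs]].
apply: (F3 _ (pi s x) (pi q (pi s x))) => //; last exact: Fsym.
by rewrite flowM abT -flowM.
Qed.

Lemma minimal_abelian_equicontinuous (T : topologicalSemigroupType)
    (X : uniformType) (pi : semiflow T X) :
  abelian T -> minimal pi -> ~ sensitive pi -> equicontinuous_semiflow pi.
Proof.
move=> abT min nsens w E entE.
have [F [entF Fsym F3]] := entourage_third _ _ entE.
have [G entG nearid] := near_identity T _ pi _ entF.
have [U [oU [x Ux] Ustab]] :=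
  not_sensitive_stable _ _ pi (F `&` G) nsens (filterI entF entG).
have U0 : U !=set0 by exists x.
have [t Utw] := minimal_visits _ _ pi w U min oU U0.
have [r Urtx] := minimal_visits _ _ pi (pi t x) U min oU U0.
rewrite flowM in Urtx.
have idF z : F (z, pi (r * t)%g z).
  by apply: (nearid abT x) => // s; have [] := Ustab _ _ Ux Urtx s.
have /nbhsP[D entD DU] : nbhs w (pi t @^-1` U).
  by apply: flow_time_continuous; exact: open_nbhs_nbhs.
exists D => // y /DU Uty s.
apply: (F3 _ _ _ _ (idF _) _ (Fsym _ _ (idF _))).
have swap v : pi (r * t)%g (pi s v) = pi (r * s)%g (pi t v).
  by rewrite -flowM (flowM pi t) abT -!flowM.
by rewrite !swap; have [] := Ustab _ _ Utw Uty (r * s)%g.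
Qed.

(** * Non-minimal M-semiflows *)

Lemma non_minimal_M_semiflow_sensitive (T : topologicalSemigroupType)
    (X : uniformType) (pi : semiflow T X) :
  M_semiflow pi -> ~ minimal pi -> sensitive pi.
Proof.
move=> [trans APdense] /existsNP[x0 nmin]; apply: contrapT => nsens.
have [z nz] : exists z, ~ closure (Defs.orbit pi x0) z.
  by apply/existsNP => all; apply: nmin; apply/seteqP; split=> // z _; exact: all.
have [E entE zfar] :
    exists2 E : set (X * X), entourage E & forall t, ~ E (z, pi t x0).
  move/existsNP: nz => [B /not_implyP[/nbhsP[E entE EB] dis]].
  exists E => // t Ez; apply: dis; exists (pi t x0); split; first by exists t.
  exact/EB/xsectionP.
have [F [entF Fsym F3]] := entourage_third _ _ entE.
have [U [oU U0 Ustab]] := not_sensitive_stable _ _ pi F nsens entF.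
pose W := interior (xsection F z).
have oW : open W by exact: open_interior.
have W0 : W !=set0 by exists z; exact: nbhs_entourage.
have [s UsW] := trans U W oU U0 oW W0.
have oUsW : open (U `&` pi s @^-1` W).
  by apply: openI => //; apply: open_comp => // v _; exact: flow_time_continuous.
have [y' [[Uy' Wsy'] APy']] := APdense _ UsW oUsW.
have [K cK Ksynd] := APy' _ (open_nbhs_nbhs (conj oUsW (conj Uy' Wsy'))).
have fC : continuous (fun p : T * X => pi s (pi p.1 p.2)).
  move=> p; apply: (@continuous_comp _ _ _ (fun p => pi p.1 p.2) (pi s)).
    exact: flow_continuous.
  exact: flow_time_continuous.
have nV := compact_family_equicontinuous _ _ _ _ K x0 F fC cK entF.
have [t [y [Uy Vty]]] := trans U _ oU U0 (open_interior _)
  (ex_intro _ x0 nV).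
have [_ [[k Kk <-] [_ Wskt]]] := Ksynd t.
apply: (zfar (s * k)%g); rewrite -flowM.
apply: (F3 _ (pi s (pi k (pi t y'))) (pi s (pi k (pi t y)))).
- by rewrite (flowM pi k); apply/xsectionP; exact: (interior_subset Wskt).
- by rewrite !flowM; exact: Ustab.
- exact/Fsym/(interior_subset Vty).
Qed.

Theorem proposition2p8 (T : topologicalSemigroupType) (X : uniformType)
    (pi : semiflow T X) :
  M_semiflow pi ->
  (~ equicontinuous_semiflow pi /\ abelian T /\
     compact [set: X] /\ hausdorff_space X)
  \/ ~ minimal pi ->
  sensitive pi.
Proof.
move=> Mpi hyp; have [min|nmin] := pselect (minimal pi); last first.
  exact: non_minimal_M_semiflow_sensitive.
case: hyp => [[neq [abT _]]|//]; apply: contrapT => nsens.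
exact/neq/minimal_abelian_equicontinuous.
Qed.
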